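(* Let $K$ be an algebraically closed field, let $n\geq 2$ be an integer and set $N=2n-1$. Let $d,a_1,\dots,a_{n-1}$ be positive integers, and suppose that $d$ is divisible by two distinct primes $p$ and $q$. Let $V\subset K^N$ be the affine toric variety, in the coordinates $x_1,\dots,x_n,y_1,\dots,y_{n-1}$ of $K^N$, given by the parametrization $$x_i=u_i\ (1\le i\le n-1),\qquad x_n=u_n^d,\qquad y_i=u_i^{a_i}u_n\ (1\le i\le n-1),$$ where $(u_1,\dots,u_n)$ ranges over $K^n$. (i) If $n=2$, then $V\subset K^3$ is defined set-theoretically by $F=y_1^d-x_1^{a_1d}x_2$. (ii) If $n=3$, then $V\subset K^5$ is defined set-theoretically by the following three binomials: $$F_1=y_1^d-x_1^{a_1d}x_3,\qquad F_2=y_2^d-x_2^{a_2d}x_3,\qquad G=y_1^{d-1}y_2-x_1^{a_1(d-1)}x_2^{a_2}x_3.$$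
   Context: A variety $V\subset K^N$ is said to be defined set-theoretically by polynomials $F_1,\dots,F_s$ if $V$ is exactly the set of common zeros of $F_1,\dots,F_s$ in $K^N$. The variety $V$ is the image of the map $K^n\to K^N$, $(u_1,\dots,u_n)\mapsto(u_1,\dots,u_{n-1},u_n^d,u_1^{a_1}u_n,\dots,u_{n-1}^{a_{n-1}}u_n)$. No assumption is made on the characteristic of $K$. *)

(* Defs.v *)
From mathcomp Require Import all_boot all_order all_algebra.
From mathcomp Require Export mpoly.

Set Implicit Arguments.
Unset Strict Implicit.
Unset Printing Implicit Defensive.

Import GRing.Theory.
Local Open Scope ring_scope.

Definition defined_set_theoretically_by (K : fieldType) (N : nat)
    (V : 'rV[K]_N -> Prop) (Fs : seq {mpoly K[N]}) : Prop :=
  forall z : 'rV[K]_N,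
    V z <-> (forall F : {mpoly K[N]}, F \in Fs -> F.@[z 0] = 0).

(* Throughout, n = m.+1, so that N = 2n - 1 = m.+1 + m.  Ordinals start at 0:
   u_(i+1) is u 0 i, and u_n is u 0 ord_max.  The first m.+1 coordinates of a
   point of K^N are x_1, ..., x_n, the last m are y_1, ..., y_(n-1). *)

Definition toric_param (K : fieldType) (m d : nat) (a : 'I_m -> nat)
    (u : 'rV[K]_m.+1) : 'rV[K]_(m.+1 + m) :=
  row_mx
    (\row_(i < m.+1) (if i == ord_max then u 0 i ^+ d else u 0 i))
    (\row_(i < m) (u 0 (widen_ord (leqnSn m) i) ^+ a i * u 0 ord_max)).

Definition toric_variety (K : fieldType) (m d : nat) (a : 'I_m -> nat)
    (z : 'rV[K]_(m.+1 + m)) : Prop :=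
  exists u : 'rV[K]_m.+1, z = toric_param d a u.

Definition xvar (K : fieldType) (m : nat) (i : 'I_m.+1) :
  {mpoly K[m.+1 + m]} := 'X_(lshift m i).

Definition yvar (K : fieldType) (m : nat) (i : 'I_m) :
  {mpoly K[m.+1 + m]} := 'X_(rshift m.+1 i).

(* Main.v *)
Require Import Defs.
From mathcomp Require Import all_boot all_order all_algebra.
From mathcomp Require Import mpoly.

Set Implicit Arguments.
Unset Strict Implicit.
Unset Printing Implicit Defensive.

Import GRing.Theory.
Local Open Scope ring_scope.

(** A point (x, y) lies on the variety iff one scalar c, playing the part of
    u_n, satisfies c ^ d = x_n and y_i = x_i ^ a_i * c for all i < n, since the
    other parameters are forced to be u_i = x_i ([toric_varietyP]).  So with
    b_i = x_i ^ a_i the question is when the system c ^ d = x_n, y_i = b_i * c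
    is solvable in c, and the equations F_i say y_i ^ d = b_i ^ d * x_n.

    - If b_i is nonzero, then c = y_i / b_i is the only candidate, and F_i says
      precisely that it is a d-th root of x_n.  If b_i = 0, then F_i forces
      y_i = 0, so the i-th equation puts no condition on c.
    - For n = 2 this settles the matter, any d-th root of x_n being suitable
      when b_1 = 0 ([common_root1]).
    - For n = 3, F_1 and F_2 only make y_1 / b_1 and y_2 / b_2 two d-th roots of
      x_n, which may differ by a root of unity.  Substituting y_1 = b_1 * c in
      G and cancelling b_1 ^ (d - 1) turns G into
      c ^ (d - 1) * y_2 = c ^ (d - 1) * (b_2 * c), which for nonzero c
      makes the two roots agree; for c = 0 they agree because then x_n = 0,
      and 0 has no other d-th root ([common_root2]).  If b_1 = 0, the first
      equation is void and the second is the case n = 2. *)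

(** All coordinates of the parameter except the last can be read off from z, so
    only c = u_n remains to be found. *)
Lemma toric_varietyP (K : fieldType) (m d : nat) (a : 'I_m -> nat)
    (z : 'rV[K]_(m.+1 + m)) :
  toric_variety d a z <->
  exists2 c : K, c ^+ d = z 0 (lshift m ord_max) &
    forall i : 'I_m, z 0 (rshift m.+1 i) =
      z 0 (lshift m (widen_ord (leqnSn m) i)) ^+ a i * c.
Proof.
have widenN (i : 'I_m) : (widen_ord (leqnSn m) i == ord_max) = false.
  by apply/negbTE; rewrite -val_eqE /= neq_ltn ltn_ord.
split=> [[u ->]|[c cd cy]].
  exists (u 0 ord_max) => [|i]; first by rewrite row_mxEl mxE eqxx.
  by rewrite row_mxEr row_mxEl !mxE widenN.
pose u : 'rV[K]_m.+1 :=
  \row_i (if i == ord_max then c else z 0 (lshift m i)).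
exists u; apply/rowP=> j; case: (split_ordP j) => i ->.
  rewrite row_mxEl !mxE; case: eqP => [->|//].
  by rewrite cd.
by rewrite row_mxEr !mxE widenN eqxx cy.
Qed.

(** The boolean form reduces, on an explicit list, to the conjunction of the
    vanishing conditions of its members. *)
Lemma all_zerosP (R : comNzRingType) (n : nat) (v : 'I_n -> R)
    (Fs : seq {mpoly R[n]}) :
  (forall F : {mpoly R[n]}, F \in Fs -> F.@[v] = 0) <->
  all (fun F => F.@[v] == 0) Fs.
Proof.
split=> [zF|/allP zF F /zF /eqP //].
by apply/allP=> F /zF ->.
Qed.

Lemma nth_root_exists (K : closedFieldType) (d : nat) (x : K) :
  (0 < d)%N -> exists c : K, c ^+ d = x.
Proof.
move=> d_gt0; have /closed_rootP[c] : size ('X^d - x%:P) != 1.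
  by rewrite size_XnsubC // eqSS -lt0n.
by rewrite /root !hornerE subr_eq0 => /eqP; exists c.
Qed.

Lemma quotient_root (K : fieldType) (d : nat) (b x y : K) :
  b != 0 -> y ^+ d = b ^+ d * x -> (y / b) ^+ d = x.
Proof. by move=> b0 e; rewrite expr_div_n e mulrC mulKf // expf_neq0. Qed.

Lemma zero_of_pow (K : fieldType) (d : nat) (x y : K) :
  (0 < d)%N -> y ^+ d = 0 ^+ d * x -> y = 0.
Proof.
move=> d_gt0; rewrite expr0n eqn0Ngt d_gt0 mul0r => /eqP.
by rewrite expf_eq0 d_gt0 => /eqP.
Qed.

(** When b = 0 the right-hand side gives y = 0, and any d-th root of x is a
    common solution; otherwise y / b is the only one. *)
Lemma common_root1 (K : closedFieldType) (d : nat) (b x y : K) :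
  (0 < d)%N ->
  (exists2 c : K, c ^+ d = x & y = b * c) <-> y ^+ d = b ^+ d * x.
Proof.
move=> d_gt0; split=> [[c <- ->]|e]; first by rewrite exprMn.
have [b0|b0] := eqVneq b 0.
  move: e; rewrite b0 => /(zero_of_pow d_gt0) ->.
  have [c cd] := nth_root_exists x d_gt0.
  by exists c; rewrite // mul0r.
by exists (y / b); [apply: quotient_root | rewrite mulrC divfK].
Qed.

(** The third equation excludes that y1 / b1 and y2 / b2 are d-th roots of x
    differing by a root of unity: modulo y1 = b1 * c it reads
    c ^ (d - 1) * y2 = c ^ (d - 1) * (b2 * c), up to the factor
    b1 ^ (d - 1). *)
Lemma common_root2 (K : closedFieldType) (d : nat) (b1 b2 x y1 y2 : K) :
  (0 < d)%N ->
  (exists2 c : K, c ^+ d = x & y1 = b1 * c /\ y2 = b2 * c) <->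
  y1 ^+ d = b1 ^+ d * x /\ y2 ^+ d = b2 ^+ d * x /\
  y1 ^+ (d - 1) * y2 = b1 ^+ (d - 1) * b2 * x.
Proof.
case: d => // d d_gt0; rewrite subn1 succnK.
split=> [[c <- [-> ->]]|[e1 [e2 g]]].
  do 2?split; rewrite ?exprMn //.
  by rewrite mulrACA -exprSr.
have [b10|b10] := eqVneq b1 0.
  (* Here y1 = 0, so only the equation for y2 constrains c. *)
  move: e1; rewrite b10 => /(zero_of_pow d_gt0) ->.
  have [c cd cy] := (common_root1 b2 x y2 d_gt0).2 e2.
  by exists c; rewrite // mul0r.
pose c := y1 / b1.
have cd : c ^+ d.+1 = x by exact: quotient_root.
have cy : y1 = b1 * c by rewrite mulrC divfK.
exists c => //; split=> //.
have [c0|c0] := eqVneq c 0.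
  (* Then x = 0, and the equation for y2 alone forces y2 = 0. *)
  rewrite c0 mulr0; apply: (@zero_of_pow _ d.+1 0 _ d_gt0).
  by rewrite e2 -cd c0 expr0n eqn0Ngt d_gt0 !mulr0.
apply: (mulfI (expf_neq0 d c0)).
apply: (mulfI (expf_neq0 d b10)).
rewrite mulrA -exprMn -cy g -cd exprSr.
by rewrite -mulrA [b2 * _]mulrCA.
Qed.

Theorem proposition2 (K : closedFieldType) (d p q : nat)
    (d_gt0 : (0 < d)%N) (p_prime : prime p) (q_prime : prime q)
    (p_neq_q : p != q) (p_dvd_d : (p %| d)%N) (q_dvd_d : (q %| d)%N) :
  (* n = 2 *)
  (forall a : 'I_1 -> nat, (forall i, (0 < a i)%N) ->
    let a1 := a (inord 0) in
    let x1 := xvar K (inord 0 : 'I_2) in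
    let x2 := xvar K (inord 1 : 'I_2) in
    let y1 := yvar K (inord 0 : 'I_1) in
    let F := y1 ^+ d - x1 ^+ (a1 * d) * x2 in
    defined_set_theoretically_by (@toric_variety K 1 d a) [:: F])
  /\
  (* n = 3 *)
  (forall a : 'I_2 -> nat, (forall i, (0 < a i)%N) ->
    let a1 := a (inord 0) in
    let a2 := a (inord 1) in
    let x1 := xvar K (inord 0 : 'I_3) in
    let x2 := xvar K (inord 1 : 'I_3) in
    let x3 := xvar K (inord 2 : 'I_3) in
    let y1 := yvar K (inord 0 : 'I_2) in
    let y2 := yvar K (inord 1 : 'I_2) in
    let F1 := y1 ^+ d - x1 ^+ (a1 * d) * x3 in
    let F2 := y2 ^+ d - x2 ^+ (a2 * d) * x3 in
    let G := y1 ^+ (d - 1) * y2 - x1 ^+ (a1 * (d - 1)) * x2 ^+ a2 * x3 in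
    defined_set_theoretically_by (@toric_variety K 2 d a) [:: F1; F2; G]).
Proof.
split=> a _ /= z; rewrite toric_varietyP all_zerosP /= !andbT;
  rewrite !(rmorphB, rmorphM, rmorphXn) /= !mevalXU !exprM !subr_eq0.
  have -> : inord 0 = ord0 :> 'I_1 by rewrite ord1.
  have -> : inord 0 = widen_ord (leqnSn 1) ord0 by apply/val_inj/inordK.
  have -> : inord 1 = ord_max :> 'I_2 by apply/val_inj/inordK.
  rewrite -(rwP eqP) -common_root1 //.
  split=> -[c cd cy]; exists c => // i.
  by rewrite ord1.
have -> : inord 0 = ord0 :> 'I_2 by apply/val_inj/inordK.
have -> : inord 1 = ord_max :> 'I_2 by apply/val_inj/inordK.
have -> : inord 0 = widen_ord (leqnSn 2) ord0 by apply/val_inj/inordK.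
have -> : inord 1 = widen_ord (leqnSn 2) ord_max by apply/val_inj/inordK.
have -> : inord 2 = ord_max :> 'I_3 by apply/val_inj/inordK.
rewrite -!(rwP andP) -!(rwP eqP) -common_root2 //.
split=> -[c cd cy]; exists c => //.
move=> i; have [->|->] : i = ord0 \/ i = ord_max.
- by case: i => [[|[|//]] ?]; [left | right]; apply: val_inj.
- exact: cy.1.
- exact: cy.2.
Qed.
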